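(* Let $T>0$, let $\alpha$ be a locally integrable function with values in $(0,1)$, let $A(s)$ denote the Laplace transform of $\alpha(t)$, and let $f\in L^1[0,T]$. Let ${}^{S}\!D^{\alpha(t)}_0$ be the regularized (Caputo–Dzhrbashyan type) Scarpi fractional derivative of variable order $\alpha(t)$, whose kernel $\phi_\alpha(t)$ is the inverse Laplace transform of $\Phi_\alpha(s)=s^{sA(s)-1}$. Then the integral operator $${}^{S}\!I^{\alpha(t)}_0 f(t)=\int_0^t\psi_\alpha(t-\tau)f(\tau)\,d\tau$$ satisfies both $${}^{S}\!D^{\alpha(t)}_0\,{}^{S}\!I^{\alpha(t)}_0 f(t)=f(t)\qquad\text{and}\qquad {}^{S}\!I^{\alpha(t)}_0\,{}^{S}\!D^{\alpha(t)}_0 f(t)=f(t)-f(0)$$ when $\psi_\alpha(t)$ is the inverse Laplace transform of $\Psi_\alpha(s)=s^{-sA(s)}$.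
   Context: The Laplace transform of a function $g$ is $\mathcal L(g(t);s)=\int_0^\infty e^{-st}g(t)\,dt$; in particular $A(s)=\int_0^\infty e^{-st}\alpha(t)\,dt$, where $\alpha$ is regarded as a function $[0,\infty)\to(0,1)$. Complex powers are $s^{z}=e^{z\ln s}$. ''The inverse Laplace transform of $G(s)$'' means a function $g(t)$ whose Laplace transform is $G(s)$; it is understood that such functions $\phi_\alpha$ and $\psi_\alpha$ exist. $L^1[0,T]$ is the space of Lebesgue-integrable functions on $[0,T]$. For $f\in L^1[0,T]$, the regularized (Caputo–Dzhrbashyan type) Scarpi fractional derivative of variable order $\alpha(t)$ is defined by $${}^{S}\!D^{\alpha(t)}_0 f(t)=\frac{d}{dt}\int_0^t\phi_\alpha(t-\tau)f(\tau)\,d\tau-\phi_\alpha(t)f(0),\qquad t\in(0,T],$$ where $\phi_\alpha(t)$ is the inverse Laplace transform of $\Phi_\alpha(s)=s^{sA(s)-1}$.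
   Formalization: The second identity is proved for those f whose convolution with φ_α agrees a.e. with an absolutely continuous function vanishing at 0, with integrable derivative; for arbitrary f in L^1 it fails (f=ψ_α on (0,T], f(0)=0). Both identities and d/dt are understood almost everywhere. *)

(* Defs.v *)
From HB Require Import structures.
From mathcomp Require Import all_boot all_order all_algebra.
From mathcomp Require Import all_classical all_reals all_analysis.
From mathcomp Require Import complex.
Set Implicit Arguments.
Unset Strict Implicit.
Unset Printing Implicit Defensive.
Import Order.TTheory GRing.Theory Num.Theory.
Import numFieldNormedType.Exports.
Local Open Scope classical_set_scope.
Local Open Scope ring_scope.
Local Open Scope complex_scope.

Section complex_powers.
Context {R : realType}.
Implicit Types s z : R[i].

Definition cexp z : R[i] :=
  (expR (complex.Re z) * cos (complex.Im z))
  +i* (expR (complex.Re z) * sin (complex.Im z)).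

(* principal argument, in ]-pi, pi]; only meaningful for z != 0 *)
Definition carg z : R :=
  if 0 <= complex.Im z then acos (complex.Re z / Normc.normc z)
  else - acos (complex.Re z / Normc.normc z).

Definition cln z : R[i] := ln (Normc.normc z) +i* carg z.

Definition cpow s z : R[i] := cexp (z * cln s).

End complex_powers.

Section laplace.
Context {R : realType}.
Local Notation mu := (@lebesgue_measure R).
Implicit Types (alpha g : R -> R) (s : R[i]) (G : R[i] -> R[i]).

Definition cintegrable (D : set R) (h : R -> R[i]) : Prop :=
  mu.-integrable D (EFin \o (fun t => complex.Re (h t))) /\
  mu.-integrable D (EFin \o (fun t => complex.Im (h t))).

Definition cintegral (D : set R) (h : R -> R[i]) : R[i] :=
  (\int[mu]_(t in D) complex.Re (h t)) +i* (\int[mu]_(t in D) complex.Im (h t)).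

Definition laplace_integrand g s (t : R) : R[i] :=
  cexp (- (s * t%:C)) * (g t)%:C.

Definition laplace g s : R[i] := cintegral `[0, +oo[ (laplace_integrand g s).

(* The transform of g is G on some right half-plane, on which the defining
   integral converges (absolutely). The half-plane avoids the cut of cln. *)
Definition inverse_laplace G g : Prop :=
  exists2 sigma : R, 0 <= sigma &
    forall s, sigma < complex.Re s ->
      cintegrable `[0, +oo[ (laplace_integrand g s) /\ laplace g s = G s.

Definition scarpi_Phi alpha s : R[i] := cpow s (s * laplace alpha s - 1).

Definition scarpi_Psi alpha s : R[i] := cpow s (- (s * laplace alpha s)).

End laplace.

Section scarpi.
Context {R : realType}.
Local Notation mu := (@lebesgue_measure R).
Implicit Types (T t : R) (alpha k f g u h w phi psi : R -> R).

Definition locally_integrable_0y alpha : Prop :=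
  forall b : R, 0 < b -> mu.-integrable `[0, b] (EFin \o alpha).

Definition L1 T f : Prop := mu.-integrable `[0, T] (EFin \o f).

Definition conv k f t : R := \int[mu]_(x in `[0, t]) (k (t - x) * f x).

Definition scarpi_integral psi f : R -> R := conv psi f.

Definition abs_continuous (a b : R) h : Prop :=
  forall e : R, 0 < e -> exists2 d : R, 0 < d &
    forall (n : nat) (x y : 'I_n -> R),
      (forall i, [/\ a <= x i, x i <= y i & y i <= b]) ->
      trivIset setT (fun i => [set` `]x i, y i[]) ->
      \sum_(i < n) (y i - x i) < d ->
      \sum_(i < n) `|h (y i) - h (x i)| < e.

(* For f in L^1 the integral defining conv k f t converges only for almost
   every t, so that its derivative has to be taken on the absolutely continuous
   representative h. The condition h 0 = u 0 (and u 0 = 0 for a convolution)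
   excludes a jump at the origin, which the values of h on ]0, T] do not see. *)
Definition ae_derivative T u w : Prop :=
  exists h : R -> R,
    [/\ abs_continuous 0 T h,
        h 0 = u 0,
        {ae mu, forall t, t \in `[0, T] -> u t = h t} &
        {ae mu, forall t, t \in `[0, T] -> is_derive t (1 : R) h (w t)}].

(* The derivative does not exist for all f in L^1, whence a relation:
   scarpi_derivative T phi f g says that g is the derivative of f. As an
   element of L^1 it is determined up to equality almost everywhere. *)
Definition scarpi_derivative T phi f g : Prop :=
  [/\ L1 T f, L1 T g &
    exists2 w : R -> R, ae_derivative T (conv phi f) w &
      {ae mu, forall t, t \in `[0, T] -> g t = w t - phi t * f 0}].

End scarpi.

(* Main.v *)
Require Import Defs.
From mathcomp Require Import all_boot all_order all_algebra.
From mathcomp Require Import all_classical all_reals all_analysis.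
From mathcomp Require Import measurable_realfun complex ring.
Import Order.TTheory GRing.Theory Num.Theory.
Import numFieldNormedType.Exports.
Local Open Scope classical_set_scope.
Local Open Scope ring_scope.

(** Write * for convolution over [[0, t]] and 1 for the constant function.

    The transforms of the kernels satisfy Phi(s) Psi(s) = s^(-1) on a common
    half-plane, and s^(-1) is the transform of 1. As the Laplace transform is
    injective and takes convolution to multiplication, phi * psi = 1 almost
    everywhere ([conv_phi_psi]).

    Hence phi * (psi * f) = 1 * f, the primitive of f. It is absolutely
    continuous with derivative f almost everywhere, and (psi * f)(0) = 0, so f
    is the Scarpi derivative of psi * f ([scarpi_derivative_integral]).

    Conversely, let g be the Scarpi derivative of f. The absolutely continuous
    representative of phi * f is 0 at 0 and has derivative g + f(0) phi, so by
    the fundamental theorem of calculus phi * f = 1 * (g + f(0) phi). Convolution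
    with psi gives 1 * f = 1 * (psi * g + f(0)), and differentiation gives
    psi * g = f - f(0) ([scarpi_integral_derivative]).

    Three facts support this. Injectivity ([laplace_nat_inj_ae]) needs the
    transform at integers only, by Phragmen's inversion formula, so the complex
    logarithm and the transforms of the kernels are evaluated at real s only.
    It also yields the commutativity and associativity of convolution almost
    everywhere, since products of numbers have these properties. Finally, an
    absolutely continuous function with zero derivative almost everywhere is
    constant ([abs_continuous_derive0]), which gives the fundamental theorem. *)

Set Implicit Arguments.
Unset Strict Implicit.
Unset Printing Implicit Defensive.

(* [conv] would otherwise denote the convex combination *)
Local Notation conv := Defs.conv.

(** * Translation invariance of the Lebesgue integral *)

Section translation.
Context {R : realType}.
Local Notation mu := (@lebesgue_measure R).

(** Both sides are measures that give an interval its length. *)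
Lemma lebesgue_measure_shift (c : R) (A : set R) : measurable A ->
  pushforward mu (fun t => t - c : measurableTypeR R) A = mu A.
Proof.
have mc : measurable_fun [set: R] (fun t => t - c : measurableTypeR R).
  exact: measurable_funB.
move=> mA; apply/esym/lebesgue_measure_unique => //= _ [[a b]] _ <-.
rewrite /pushforward /=.
have -> : (fun t : R => t - c) @^-1` `]a, b]%classic = `]a + c, b + c]%classic.
  by apply/seteqP; split => t /=; rewrite !in_itv/= ltrBrDr lerBlDr.
rewrite !lebesgue_measure_itv/= !lte_fin ltrD2r.
by case: ifP => // _; congr (_%:E); ring.
Qed.

Lemma ge0_integral_shift (f : R -> \bar R) (c : R) :
  measurable_fun [set: R] f -> (forall x, 0 <= f x)%E ->
  (\int[mu]_t f (t - c)%R = \int[mu]_t f t)%E.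
Proof.
move=> mf f0.
have mc : measurable_fun [set: R] (fun t => t - c : measurableTypeR R).
  exact: measurable_funB.
transitivity (\int[pushforward mu (fun t => t - c : measurableTypeR R)%R]_t f t)%E.
  by rewrite ge0_integral_pushforward//= preimage_setT.
by apply: eq_measure_integral => A mA _; exact: lebesgue_measure_shift.
Qed.

Lemma integral_shift (f : R -> \bar R) (c : R) :
  measurable_fun [set: R] f ->
  (\int[mu]_t f (t - c)%R = \int[mu]_t f t)%E.
Proof.
move=> mf; rewrite [RHS]integralE [LHS]integralE.
rewrite -(@ge0_integral_shift (f^\+)%E c); last 2 first.
- exact: measurable_funepos.
- by move=> x; exact: funepos_ge0.
rewrite -(@ge0_integral_shift (f^\-)%E c); last 2 first.
- exact: measurable_funeneg.
- by move=> x; exact: funeneg_ge0.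
by congr (_ - _)%E; apply: eq_integral => t _; rewrite ?funeposE ?funenegE.
Qed.

End translation.

(** * Convolution on the line *)

Section convolution.
Context {R : realType}.
Local Notation mu := (@lebesgue_measure R).
Implicit Types a b : R -> R.

(** Convolution over the whole line. It agrees with the convolution over
    [[0, t]] on functions that vanish on the negative axis, and Fubini applies
    to it without a moving domain. *)
Definition convT a b (t : R) : R := \int[mu]_x (a (t - x) * b x).

Let tensor a b (p : R * R) : \bar R := (a (p.1 - p.2) * b p.2)%:E.

Let measurable_tensor a b : measurable_fun [set: R] a ->
  measurable_fun [set: R] b -> measurable_fun [set: R * R] (tensor a b).
Proof.
move=> ma mb; apply/measurable_EFinP/measurable_funM.
  by apply: (measurableT_comp ma); exact: measurable_funB.
by apply: (measurableT_comp mb).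
Qed.

Let integrable_tensor a b : mu.-integrable setT (EFin \o a) ->
  mu.-integrable setT (EFin \o b) ->
  (mu \x mu)%E.-integrable setT (tensor a b).
Proof.
move=> ia ib; have /measurable_EFinP ma := measurable_int _ ia.
have /measurable_EFinP mb := measurable_int _ ib.
have mt := measurable_tensor ma mb.
apply/(integrable21ltyP mu mu mt).
have maa : measurable_fun [set: R] (fun t => `|(a t)%:E|%E).
  by apply: measurableT_comp => //; exact/measurable_EFinP.
have fina : (\int[mu]_t `|(a t)%:E| < +oo)%E by case/integrableP : ia.
have E x : (\int[mu]_t `|tensor a b (t, x)| =
    (\int[mu]_t `|(a t)%:E|) * `|(b x)%:E|)%E.
  under eq_integral do rewrite /tensor/= normrM EFinM.
  rewrite ge0_integralZr //=; last first.
    apply/measurable_EFinP; apply: measurableT_comp => //.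
    by apply: (measurableT_comp ma); exact: measurable_funB.
  by rewrite (ge0_integral_shift (f := fun t => `|(a t)%:E|%E)).
under eq_integral do rewrite E.
rewrite ge0_integralZl//.
- rewrite lte_mul_pinfty//; first exact: integral_ge0.
    by rewrite ge0_fin_numE//; exact: integral_ge0.
  by case/integrableP: ib.
- by apply: measurableT_comp => //; exact/measurable_EFinP.
- exact: integral_ge0.
Qed.

Lemma convT_ae_integrable a b : mu.-integrable setT (EFin \o a) ->
  mu.-integrable setT (EFin \o b) ->
  {ae mu, forall t, mu.-integrable setT (EFin \o (fun x => a (t - x) * b x))}.
Proof. by move=> ia ib; exact: (ae_integrable1 (integrable_tensor ia ib)). Qed.

Lemma integrable_convT a b : mu.-integrable setT (EFin \o a) ->
  mu.-integrable setT (EFin \o b) -> mu.-integrable setT (EFin \o convT a b).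
Proof.
move=> ia ib; have it := integrable_tensor ia ib.
have iF := integrable_fubini_F it.
apply: (le_integrable measurableT _ _ iF) => /=.
  apply/measurable_EFinP.
  by apply: measurableT_comp => //; exact: (measurable_int _ iF).
by move=> t _; rewrite /convT /Rintegral /fubini_F /tensor/=;
  case: integral => [r| |] //=; rewrite normr0 leey.
Qed.

(** Fubini, and the invariance of the integral under translation. *)
Lemma Rintegral_convT a b : mu.-integrable setT (EFin \o a) ->
  mu.-integrable setT (EFin \o b) ->
  \int[mu]_t convT a b t = (\int[mu]_t a t) * (\int[mu]_t b t).
Proof.
move=> ia ib; have it := integrable_tensor ia ib.
have iF := integrable_fubini_F it.
have /measurable_EFinP ma := measurable_int _ ia.
rewrite [LHS]/Rintegral.
rewrite (_ : integral _ _ _ = \int[mu]_t fubini_F mu (tensor a b) t)%E; last first.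
  apply: ae_eq_integral => //.
  - exact: (measurable_int _ (integrable_convT ia ib)).
  - exact: (measurable_int _ iF).
  - have := integrable_ae measurableT iF.
    apply: filterS => t /(_ I) fint _.
    by rewrite /convT /Rintegral fineK.
rewrite (Fubini it).
have E x : (\int[mu]_t tensor a b (t, x) = (\int[mu]_t (a t)%:E) * (b x)%:E)%E.
  rewrite /tensor/= -(@integral_shift _ (EFin \o a) x) /=; last exact/measurable_EFinP.
  rewrite muleC -integralZl//; last first.
    apply/integrableP; split.
      apply/measurable_EFinP.
      by apply: (measurableT_comp ma); exact: measurable_funB.
    rewrite (ge0_integral_shift (f := fun t => `|(a t)%:E|%E))//.
      by case/integrableP : ia.
    by apply: measurableT_comp => //; exact/measurable_EFinP.
  by apply: eq_integral => t _; rewrite /= EFinM muleC.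
under eq_integral do rewrite E.
have fa : (\int[mu]_t (a t)%:E)%E \is a fin_num by exact: integrable_fin_num ia.
rewrite -(fineK fa) integralZl//= fineM//.
exact: integrable_fin_num ib.
Qed.

End convolution.

(** * Causal functions and their Laplace transform *)

Section causal.
Context {R : realType}.
Local Notation mu := (@lebesgue_measure R).
Implicit Types a b u : R -> R.

Definition causal u := forall t, t < 0 -> u t = 0.

Definition causalL1 u := mu.-integrable setT (EFin \o u) /\ causal u.

Lemma measurable_causalL1 u : causalL1 u -> measurable_fun [set: R] u.
Proof. by case=> iu _; have /measurable_EFinP := measurable_int _ iu. Qed.

Lemma eq_conv (a a' b b' : R -> R) (t : R) : (forall x, 0 <= x <= t -> a x = a' x) ->
  (forall x, 0 <= x <= t -> b x = b' x) -> conv a b t = conv a' b' t.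
Proof.
move=> aa' bb'; apply: eq_Rintegral => x /set_mem/=; rewrite in_itv/= => /andP[x0 xt].
by rewrite aa' ?bb' ?x0 ?xt// subr_ge0 xt gerBl.
Qed.

Lemma convT_causalE a b : causal a -> causal b -> convT a b = conv a b.
Proof.
move=> ca cb; apply/funext => t; rewrite /conv Rintegral_mkcond.
apply: eq_Rintegral => x _; rewrite patchE.
case: ifPn => //; rewrite notin_setE/= in_itv/= => /negP/nandP[].
  by rewrite -ltNge => /cb ->; rewrite mulr0.
by rewrite -ltNge -subr_lt0 => /ca ->; rewrite mul0r.
Qed.

Lemma conv_causal a b : causal (conv a b).
Proof.
by move=> t t0; rewrite /conv set_itv_ge ?Rintegral_set0// bnd_simp -ltNge.
Qed.

Lemma causalL1_convT a b : causalL1 a -> causalL1 b -> causalL1 (convT a b).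
Proof.
move=> [ia ca] [ib cb]; split; first exact: integrable_convT.
by rewrite convT_causalE//; exact: conv_causal.
Qed.

Lemma causalL1B a b : causalL1 a -> causalL1 b -> causalL1 (a \- b).
Proof.
move=> [ia ca] [ib cb]; split; last by move=> t t0; rewrite /= ca// cb// subr0.
by have := integrableB measurableT ia ib.
Qed.

(** A real integral that is infinite or undefined is read as 0, so a nonzero
    factor can be taken out even where the integral diverges. This makes
    [damp_convT] an identity at every point. *)
Lemma RintegralZl_measurable (D : set R) (f : R -> R) (k : R) :
  measurable D -> measurable_fun D f -> k != 0 ->
  \int[mu]_(x in D) (k * f x) = k * \int[mu]_(x in D) f x.
Proof.
move=> mD mf k0; have [fi|fi] := pselect (mu.-integrable D (EFin \o f)).
  exact: RintegralZl.
have nonint (g : R -> R) : measurable_fun D g -> ~ mu.-integrable D (EFin \o g) ->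
    \int[mu]_(x in D) g x = 0.
  move=> mg ng; rewrite /Rintegral.
  case E : (\int[mu]_(x in D) (g x)%:E)%E => [r| |] //=.
  exfalso; apply: ng; apply/integrableP; split; first exact/measurable_EFinP.
  by rewrite /= (integral_fin_num_abs mu mD mg) E.
rewrite [in RHS]nonint// nonint ?mulr0//; first exact: measurable_funM.
move=> ikf; apply: fi; have := @integrableZl _ _ _ mu D mD k^-1 _ ikf.
apply: eq_integrable => // x _ /=.
by rewrite -EFinM mulKf.
Qed.

Definition damp (s : R) u t := expR (- (s * t)) * u t.

Lemma measurable_damp (D : set R) s u : measurable_fun D u ->
  measurable_fun D (damp s u).
Proof.
move=> mu_; apply: measurable_funM => //; apply: measurableT_comp => //.
by apply: measurable_funN; apply: measurable_funM.
Qed.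

Lemma causal_damp s u : causal u -> causal (damp s u).
Proof. by move=> cu t t0; rewrite /damp cu// mulr0. Qed.

Lemma causalL1_damp s u : 0 <= s -> causalL1 u -> causalL1 (damp s u).
Proof.
move=> s0 [iu cu]; split; last exact: causal_damp.
have /measurable_EFinP mu_ := measurable_int _ iu.
apply: le_integrable iu => //.
  by apply/measurable_EFinP; exact: measurable_damp.
move=> t _ /=; rewrite lee_fin normrM; have [t0|t0] := ltP t 0.
  by rewrite cu// normr0 mulr0.
rewrite ler_piMl// ger0_norm ?expR_ge0//.
by rewrite -expR0 ler_expR oppr_le0 mulr_ge0.
Qed.

Lemma damp_convT s a b : measurable_fun [set: R] a -> measurable_fun [set: R] b ->
  convT (damp s a) (damp s b) = damp s (convT a b).
Proof.
move=> ma mb; apply/funext => t; rewrite /convT [RHS]/damp.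
rewrite -RintegralZl_measurable//; last 2 first.
- apply: measurable_funM => //.
  by apply: (measurableT_comp ma); exact: measurable_funB.
- by rewrite gt_eqF// expR_gt0.
apply: eq_Rintegral => x _; rewrite /damp mulrACA -expRD.
by congr (expR _ * _); ring.
Qed.

(** The Laplace transform at the integers, which already determines an
    integrable causal function (see [laplace_nat_inj_ae]). *)
Definition laplace_nat u (n : nat) : R := \int[mu]_t damp n%:R u t.

(** An exponential weight distributes over a convolution, so the product
    formula at [n] is the one for total integrals ([Rintegral_convT]). *)
Lemma laplace_nat_convT a b n : causalL1 a -> causalL1 b ->
  laplace_nat (convT a b) n = laplace_nat a n * laplace_nat b n.
Proof.
move=> ha hb; rewrite /laplace_nat.
have [ia _] : causalL1 (damp n%:R a) by exact: causalL1_damp.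
have [ib _] : causalL1 (damp n%:R b) by exact: causalL1_damp.
rewrite -Rintegral_convT// damp_convT//; exact: measurable_causalL1.
Qed.

Lemma laplace_natB a b n : causalL1 a -> causalL1 b ->
  laplace_nat (a \- b) n = laplace_nat a n - laplace_nat b n.
Proof.
move=> ha hb; rewrite /laplace_nat.
have [ia _] : causalL1 (damp n%:R a) by exact: causalL1_damp.
have [ib _] : causalL1 (damp n%:R b) by exact: causalL1_damp.
rewrite -RintegralB//.
by apply: eq_Rintegral => t _; rewrite /damp/= mulrBr.
Qed.

End causal.

(** * Uniqueness for the Laplace transform *)

Section uniqueness.
Context {R : realType}.
Local Notation mu := (@lebesgue_measure R).
Implicit Types u v w : R -> R.

(** With y = y0 e^(-m t), the function exp(-y) is a power series in e^(-m t), so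
    its integral against [u] is a combination of values of the transform of [u]
    at multiples of [m]. On the positive axis the partial sums are bounded by
    e^y0, which allows integration term by term. *)
Lemma laplace_nat0_exp_kernel u (y0 : R) (m : nat) : 0 <= y0 -> causalL1 u ->
  (forall n, laplace_nat u n = 0) ->
  (\int[mu]_t (expR (- (y0 * expR (- (m%:R * t)))) * u t)%:E = 0)%E.
Proof.
move=> y00 hu u0; have [iu cu] := hu; have mu_ := measurable_causalL1 hu.
pose y t := y0 * expR (- (m%:R * t)).
have my : measurable_fun [set: R] y.
  apply: measurable_funM => //; apply: measurableT_comp => //.
  by apply: measurable_funN; apply: measurable_funM.
pose S N t : R := series (exp_coeff (- y t)) N * u t.
(* termwise, y ^ k times u is the function u with weight e^(- m k t) *)
have SE N t : S N t =
    \sum_(0 <= k < N) ((- y0) ^+ k / k`!%:R * damp (m * k)%:R u t).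
  rewrite /S /series/= mulr_suml; apply: eq_bigr => k _.
  rewrite /exp_coeff/= /damp /y -mulNr exprMn -expRM_natl natrM.
  rewrite mulrN mulrA [k%:R * m%:R]mulrC; ring.
have iS N : mu.-integrable setT (EFin \o S N).
  have -> : EFin \o S N = fun t => (\sum_(0 <= k < N)
      ((- y0) ^+ k / k`!%:R * damp (m * k)%:R u t)%:E)%E.
    by apply/funext => t; rewrite /= SE sumEFin.
  apply: integrable_sum => // k _.
  have [id _] : causalL1 (damp (m * k)%:R u) by exact: causalL1_damp.
  exact: (@integrableZl _ _ _ mu setT measurableT _ _ id).
have IS N : (\int[mu]_t (S N t)%:E = 0)%E.
  under eq_integral do rewrite SE -sumEFin.
  rewrite integral_sum//= ?big1// => [k _|k].
    have [id _] : causalL1 (damp (m * k)%:R u) by exact: causalL1_damp.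
    under eq_integral do rewrite EFinM.
    rewrite (@integralZl _ _ _ mu setT measurableT _ id)//.
    rewrite -[X in (_ * X)%E]fineK; last exact: integrable_fin_num id.
    by have := u0 (m * k)%N; rewrite /laplace_nat /Rintegral => ->; rewrite mule0.
  have [id _] : causalL1 (damp (m * k)%:R u) by exact: causalL1_damp.
  exact: (@integrableZl _ _ _ mu setT measurableT _ _ id).
have [|||||_ _] := @dominated_convergence _ _ _ mu setT measurableT
   (fun N => EFin \o S N) (fun t => (expR (- y t) * u t)%:E)
   (fun t => (expR y0 * `|u t|)%:E).
- by move=> n; exact: (measurable_int _ (iS n)).
- apply/measurable_EFinP/measurable_funM => //; apply: measurableT_comp => //.
  exact: measurable_funN.
- apply: aeW => t _ /=; apply: cvg_EFin; first exact: nearW.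
  apply: cvgMl.
  exact: is_cvg_series_exp_coeff.
- have := @integrableZl _ _ _ mu setT measurableT (expR y0) _ (integrable_abse iu).
  by apply: eq_integrable.
- apply: aeW => t N _ /=; rewrite lee_fin normrM.
  have [t0|t0] := ltP t 0; first by rewrite cu// normr0 !mulr0.
  rewrite ler_wpM2r//.
  have yt0 : 0 <= y t by rewrite mulr_ge0// expR_ge0.
  have yt : y t <= y0.
    by rewrite ler_piMr// -expR0 ler_expR oppr_le0 mulr_ge0.
  apply: (@le_trans _ _ (expR (y t))); last by rewrite ler_expR.
  apply: (@le_trans _ _ (series (exp_coeff (y t)) N)).
    rewrite /series/=; apply: le_trans (ler_norm_sum _ _ _) _.
    apply: ler_sum => k _; rewrite /exp_coeff/= normrM normrX normrN.
    by rewrite !ger0_norm// invr_ge0.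
  apply: nondecreasing_cvgn_le; last exact: is_cvg_series_exp_coeff.
  apply: nondecreasing_series => k _ _.
  by rewrite /exp_coeff/= divr_ge0// exprn_ge0.
rewrite (_ : [sequence _]_n = cst 0%E); last by apply/funext => N /=; exact: IS.
move=> c0.
have /= := cvg_lim (@ereal_hausdorff R) c0.
by rewrite lim_cst// => <-.
Qed.

Lemma cvgn_mulr_pinfty (c : R) : 0 < c -> c * m%:R @[m --> \oo] --> +oo.
Proof.
move=> c0; apply/cvgryPge => A; near=> m.
rewrite -ler_pdivrMl//; near: m; exact: nbhs_infty_ger.
Unshelve. all: by end_near. Qed.

(** Phragmen's inversion argument: exp(-e^(m (a - t))) tends, as m grows, to
    the indicator of the half-line beyond [a], boundedly and at all t but [a]. *)
Lemma laplace_nat0_tail u (a : R) : causalL1 u -> (forall n, laplace_nat u n = 0) ->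
  \int[mu]_(t in `]a, +oo[) u t = 0.
Proof.
move=> hu u0; have [iu cu] := hu; have mu_ := measurable_causalL1 hu.
pose K (m : nat) (t : R) := expR (- (expR (m%:R * a) * expR (- (m%:R * t)))).
have KE m t : K m t = expR (- expR (m%:R * (a - t))).
  by rewrite /K -expRD; congr (expR (- expR _)); ring.
have [|||||_ _] := @dominated_convergence _ _ _ mu setT measurableT
   (fun m t => (K m t * u t)%:E) (fun t => (u \_ `]a, +oo[ t)%:E)
   (fun t => `|u t|%:E).
- move=> m; apply/measurable_EFinP/measurable_funM => //.
  apply: measurableT_comp => //; apply: measurable_funN.
  apply: measurable_funM => //; apply: measurableT_comp => //.
  by apply: measurable_funN; apply: measurable_funM.
- apply/measurable_EFinP/(measurable_restrictT _ _).1 => //.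
  exact: measurable_funS mu_.
- exists [set a]; split => //; first exact: lebesgue_measure_set1.
  move=> t /= /not_implyP[_]; apply: contra_notP => /eqP ta.
  apply: cvg_EFin; first exact: nearW.
  rewrite [X in X @ _](_ : _ =
      fun m => expR (- expR (m%:R * (a - t))) * u t); last first.
    by apply/funext => m /=; rewrite KE.
  rewrite patchE; move: ta; rewrite neq_lt => /orP[ta|ta]; last first.
    rewrite mem_set/= ?in_itv/= ?ta// -[X in _ --> X]mul1r; apply: cvgMl.
    rewrite -[X in _ --> X]expR0 -[X in expR X]oppr0.
    apply: (@continuous_cvg _ _ _ _ _ _ (@expR R)); first exact: continuous_expR.
    apply: cvgN.
    under eq_cvg do rewrite -opprB mulrN mulrC.
    apply: (@cvg_comp _ _ _ (fun m => (t - a) * m%:R) (fun x : R => expR (- x))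
      _ _ _ _ (@cvgr_expR R)).
    by apply: cvgn_mulr_pinfty; rewrite subr_gt0.
  have -> : (if t \in `]a, +oo[%classic then u t else point) = 0 * u t.
    by rewrite mul0r memNset//= in_itv/= andbT; apply/negP; rewrite -leNgt ltW.
  apply: cvgMl.
  apply: (@cvg_comp _ _ _ (fun m => expR (m%:R * (a - t))) (fun x => expR (- x))
      _ _ _ _ (@cvgr_expR R)).
  apply/cvgryPge => A; have at0 : 0 < a - t by rewrite subr_gt0.
  move/cvgryPge: (cvgn_mulr_pinfty at0) => /(_ A).
  apply: filterS => m /le_trans; apply.
  by apply: le_trans (expR_ge1Dx _); rewrite mulrC lerDr.
- exact: integrable_norm.
- apply: aeW => t N _ /=; rewrite lee_fin normrM ler_piMl// ger0_norm ?expR_ge0//.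
  by rewrite -expR0 ler_expR oppr_le0 mulr_ge0// expR_ge0.
rewrite (_ : [sequence _]_n = cst 0%E); last first.
  apply/funext => m.
  exact: (@laplace_nat0_exp_kernel _ _ m (expR_ge0 (m%:R * a)) hu u0).
move=> c0.
have /= := cvg_lim (@ereal_hausdorff R) c0.
by rewrite Rintegral_mkcond /Rintegral lim_cst// => <-.
Qed.

End uniqueness.

(** * Primitives of integrable functions *)

Section primitive.
Context {R : realType}.
Local Notation mu := (@lebesgue_measure R).
Implicit Types (v w h : R -> R) (T : R).

Definition primitive v t : R := \int[mu]_(x in `[0, t]) v x.

Lemma primitive0 v : primitive v 0 = 0.
Proof. by rewrite /primitive set_itv1 Rintegral_set1. Qed.

Lemma primitiveB_le v x y : mu.-integrable setT (EFin \o v) ->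
  0 <= x <= y -> `|primitive v y - primitive v x| <= \int[mu]_(t in `]x, y[) `|v t|.
Proof.
move=> iv /andP[x0 xy]; have iS A : measurable A -> mu.-integrable A (EFin \o v).
  by move=> mA; apply: integrableS iv.
rewrite /primitive Rintegral_itvB ?bnd_simp//; last exact: iS.
rewrite -Rintegral_itv_bndo_bndc; last exact: iS.
by apply: le_normr_Rintegral => //; exact: iS.
Qed.

(** The integral of |v| over a finite union of disjoint intervals is small with
    its measure. *)
Lemma abs_continuous_primitive T v : mu.-integrable setT (EFin \o v) ->
  abs_continuous 0 T (primitive v).
Proof.
move=> iv e e0; have [d [d0 dP]] := integral_normr_continuous iv e0.
exists d => // n x y xy txy sd.
pose F i : set R := `]x i, y i[%classic.
have mF i : measurable (F i) by exact: measurable_itv.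
have mFx (i : 'I_n) : mu (F i) = (y i - x i)%:E.
  have [_ xyi _] := xy i; rewrite /F lebesgue_measure_itv/= lte_fin.
  case: ifPn => [_|]; first by rewrite EFinN.
  by rewrite -leNgt => yxi; rewrite (@le_anti _ _ (x i) (y i)) ?subrr ?xyi.
pose D := \big[setU/set0]_(i < n) F i.
have mD : measurable D by exact: bigsetU_measurable.
have muD : mu D = (\sum_(i < n) (y i - x i))%:E.
  rewrite measure_semi_additive_ord// -sumEFin.
  by apply: eq_bigr => i _; exact: mFx.
have {}sd : (mu D < d%:E)%E by rewrite muD lte_fin.
apply: le_lt_trans (dP D mD sd).
have inv A : measurable A -> mu.-integrable A (EFin \o (fun t => `|v t|)).
  by move=> mA; apply: (integrableS measurableT) => //; exact: integrable_norm.
rewrite [leRHS]/Rintegral integral_bigsetU_EFin//; last 3 first.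
- exact: index_enum_uniq.
- by apply: sub_trivIset txy.
- exact: (measurable_int _ (inv _ mD)).
rewrite -sum_fine; last first.
  move=> i _.
  exact: (@integrable_fin_num _ _ _ mu _ (mF i) _ (inv _ (mF i))).
by apply: ler_sum => i _; have [x0 xyi _] := xy i; apply: primitiveB_le; rewrite ?x0.
Qed.

Lemma abs_continuous_dist (a b : R) h (e : R) : abs_continuous a b h -> 0 < e ->
  exists2 d : R, 0 < d &
    forall x y, a <= x -> x <= y -> y <= b -> y - x < d -> `|h y - h x| < e.
Proof.
move=> ach /ach[d d0 dP]; exists d => // x y ax xy yb yxd.
have := dP 1 (fun=> x) (fun=> y).
rewrite !big_ord1; apply => //.
by apply/trivIsetP => i j _ _; rewrite !ord1 eqxx.
Qed.

Lemma ae_is_derive_primitive v : mu.-integrable setT (EFin \o v) ->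
  {ae mu, forall t : R, 0 < t -> is_derive t (1 : R) (primitive v) (v t)}.
Proof.
move=> iv; have ivy y : mu.-integrable [set` Interval (BLeft 0) (BRight y)] (EFin \o v).
  by apply: integrableS iv.
have := FTC1 ivy (open_integrable_locally openT iv).
apply: (@filterS _ _ (ae_filter_ringOfSetsType mu)) => t /= + t0.
rewrite lte_fin => /(_ t0)[dv vt].
by rewrite -vt derive1E; exact: derivableP.
Qed.

Lemma ae_neq (c : R) : {ae mu, forall t : R, t != c}.
Proof.
exists [set c]; split => //; first exact: lebesgue_measure_set1.
by move=> t /= /negP/negPn/eqP.
Qed.

Lemma ae_itvoo (P : R -> Prop) (x y : R) : {ae mu, forall t, P t} -> x < y ->
  exists2 z, x < z < y & P z.
Proof.
move=> [N [mN N0 PN]] xy; apply: contrapT => nz.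
have sub : `]x, y[%classic `<=` N.
  move=> z /= /[!in_itv]/= xzy; apply: PN => /= Pz.
  by apply: nz; exists z.
have : (mu `]x, y[ <= mu N)%E by apply: le_measure; rewrite ?inE.
by rewrite N0 lebesgue_measure_itv/= lte_fin xy -EFinB lee_fin leNgt subr_gt0 xy.
Qed.

(** The primitive is continuous, so it vanishes on the whole interval, and [v]
    is its derivative almost everywhere. *)
Lemma primitive_ae0 T v : mu.-integrable setT (EFin \o v) ->
  {ae mu, forall t : R, t \in `[0, T] -> primitive v t = 0} ->
  {ae mu, forall t : R, t \in `[0, T] -> v t = 0}.
Proof.
move=> iv v0; have p0 (t : R) : 0 < t < T -> primitive v t = 0.
  move=> /andP[t0 tT]; apply/eqP; rewrite -normr_eq0; apply/eqP.
  apply/le_anti; rewrite normr_ge0 andbT; apply/ler_addgt0Pr => e e0; rewrite add0r ltW//.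
  have [d d0 dP] := abs_continuous_dist (@abs_continuous_primitive T _ iv) e0.
  have m0 : t < t + Num.min d (T - t) by rewrite ltrDl lt_min d0 subr_gt0.
  have [z /andP[tz]] := ae_itvoo v0 m0.
  rewrite -ltrBlDl lt_min ltrD2r => /andP[ztd zT] pz.
  have := dP t z (ltW t0) (ltW tz) (ltW zT) ztd.
  by rewrite pz ?sub0r ?normrN// in_itv/= (ltW zT) (le_trans (ltW t0) (ltW tz)).
have : {ae mu, forall t : R, 0 < t -> is_derive t (1 : R) (primitive v) (v t)}.
  exact: ae_is_derive_primitive.
apply: (@filterS3 _ _ (ae_filter_ringOfSetsType mu)) (ae_neq 0) (ae_neq T) => t tn0 tnT dv.
rewrite in_itv/= => /andP[t0 tT].
have t0' : 0 < t by rewrite lt_neqAle eq_sym tn0.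
have tT' : t < T by rewrite lt_neqAle tnT.
have := dv t0'.
have d0 : is_derive t (1 : R) (primitive v) 0.
  apply: near_eq_is_derive (is_derive_cst 0 t 1).
  have /near_in_itvoo : t \in `]0, T[ by rewrite in_itv/= t0' tT'.
  by apply: filterS => x; rewrite in_itv/= => /p0 ->.
by move=> [_ <-]; case: d0.
Qed.

End primitive.

(** * Absolutely continuous functions with zero derivative *)

Section absolute_continuity.
Context {R : realType}.
Local Notation mu := (@lebesgue_measure R).
Implicit Types (h w : R -> R) (T c : R) (U : set R) (s : seq (R * R)).

Lemma is_derive0_near h (t e : R) : is_derive t (1 : R) h 0 -> 0 < e ->
  exists2 r : R, 0 < r & forall y, `|y - t| < r -> `|h y - h t| <= e * `|y - t|.
Proof.
move=> [dh h0] e0.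
have : (fun x : R => x^-1 *: (h (x *: (1 : R) + t) - h t)) @ 0^' --> ('D_1 h t : R).
  exact: dh.
rewrite h0.
move/cvgrPdist_le => /(_ _ e0)[r /= r0 rP]; exists r => // y ytr.
have [->|yt] := eqVneq y t; first by rewrite !subrr normr0 mulr0.
have /= := rP (y - t); rewrite sub0r normrN sub0r normrN subr_eq0.
rewrite [_ *: (1 : R)]mulr1 subrK => /(_ ytr yt).
rewrite normrM normfV mulrC ler_pdivrMr// normr_gt0 subr_eq0//.
Qed.

(** A list of successive intervals inside [U], the last one first, lying
    between 0 and [c]. This form lets an interval be added at the right end;
    the family of disjoint intervals that absolute continuity asks for is
    read off it in [abs_continuous_chain]. *)
Fixpoint chain U c s : Prop :=
  if s is p :: s' then
    [/\ p.1 <= p.2, p.2 <= c, `]p.1, p.2[%classic `<=` U & chain U p.1 s']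
  else 0 <= c.

Lemma chain_le U c d s : c <= d -> chain U c s -> chain U d s.
Proof.
case: s => [|p s] /= cd; first by move=> /le_trans; exact.
by move=> [? /le_trans pc ? ?]; split => //; exact: pc.
Qed.

Lemma chain_bounds U c s p : chain U c s -> p \in s ->
  [/\ 0 <= p.1, p.1 <= p.2 & p.2 <= c].
Proof.
elim: s c => // q s ih c [q12 q2c qU /= cs]; rewrite inE => /predU1P[->|/(ih _ cs)].
  split => //; elim: s q.1 cs {ih q12} => //= r s ih x [r12 r2x _ /ih r1].
  exact: (le_trans r1 (le_trans r12 r2x)).
by move=> [p1 p12 p2q]; split => //; apply: (le_trans p2q); exact: le_trans q2c.
Qed.

Lemma chain_length U c s : measurable U -> chain U c s ->
  ((\sum_(p <- s) (p.2 - p.1))%:E <= mu (U `&` `]-oo, c[%classic))%E.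
Proof.
move=> mU; elim: s c => [|p s ih] c; first by rewrite big_nil.
move=> [p12 p2c pU /ih cs]; rewrite big_cons EFinD addeC.
have mUp : measurable (U `&` `]-oo, p.1[%classic) by exact: measurableI.
apply: (@le_trans _ _ (mu (U `&` `]-oo, p.1[%classic) + mu `]p.1, p.2[%classic)%E).
  apply: leeD => //; rewrite lebesgue_measure_itv/= lte_fin.
  case: ifPn => [_|]; first by rewrite EFinN.
  by rewrite -leNgt => p21; rewrite lee_fin subr_le0.
rewrite -measureU//.
- apply: le_measure; rewrite ?inE//.
  + exact: measurableU.
  + exact: measurableI.
  + move=> x /= [[Ux]|]; rewrite !in_itv/= => xp; split => //.
    * by apply: (lt_le_trans xp); apply: le_trans p2c.
    * by apply: pU; rewrite /= in_itv.
    * by case/andP: xp => _ xp; exact: lt_le_trans p2c.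
- apply/seteqP; split => // x [[_ /=]]; rewrite !in_itv/= => xp /andP[px _].
  by move: (lt_trans xp px); rewrite ltxx.
Qed.

Lemma chain_sorted U c s i j p0 : chain U c s -> (i < j)%N -> (j < size s)%N ->
  (nth p0 s j).2 <= (nth p0 s i).1.
Proof.
elim: s c i j => // q s ih c [|i] [|j]//= [_ _ _ cs]; rewrite !ltnS => ij js; last first.
  exact: ih cs ij js.
by have [] := chain_bounds cs (mem_nth p0 js).
Qed.

Lemma abs_continuous_chain T h (d e : R) U c s :
  (forall (n : nat) (x y : 'I_n -> R),
      (forall i, [/\ 0 <= x i, x i <= y i & y i <= T]) ->
      trivIset setT (fun i => [set` `]x i, y i[]) ->
      \sum_(i < n) (y i - x i) < d ->
      \sum_(i < n) `|h (y i) - h (x i)| < e) ->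
  measurable U -> (mu U < d%:E)%E -> c <= T -> chain U c s ->
  \sum_(p <- s) `|h p.2 - h p.1| < e.
Proof.
move=> hP mU Ud cT cs.
pose p i := nth (0, 0) s i.
have sumE (F : R * R -> R) : \sum_(q <- s) F q = \sum_(i < size s) F (p i).
  by rewrite (big_nth (0, 0)) big_mkord.
rewrite sumE; apply: (hP _ (fun i => (p i).1) (fun i => (p i).2)).
- move=> i; have [] := chain_bounds cs (mem_nth (0, 0) (ltn_ord i)).
  by move=> ? ? p2; split => //; exact: le_trans cT.
- have disj (i j : 'I_(size s)) : (i < j)%N ->
      `](p i).1, (p i).2[%classic `&` `](p j).1, (p j).2[%classic = set0.
    move=> ij; have := chain_sorted (0, 0) cs ij (ltn_ord j).
    rewrite -/(p i) -/(p j) => pji; apply/seteqP; split => // x [] /=.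
    rewrite !in_itv/= => /andP[pix _] /andP[_ xpj].
    by have := lt_trans pix (lt_le_trans xpj pji); rewrite ltxx.
  apply/trivIsetP => i j _ _ /eqP/val_eqP/=; rewrite neq_ltn => /orP[ij|ji].
    exact: disj.
  by rewrite setIC; exact: disj.
- rewrite -(sumE (fun q => q.2 - q.1)) -lte_fin.
  apply: le_lt_trans (chain_length mU cs) (le_lt_trans _ Ud).
  by apply: le_measure; rewrite ?inE//; exact: measurableI.
Qed.

(** Let N be the null set of the points at which the derivative need not be 0,
    and U an open set of small measure containing N. On the way from 0 to T,
    near a point outside N the increment of h is at most e times the length;
    near a point of N one records an interval inside U instead. The recorded
    increments add up to at most e by absolute continuity, so
    |h T - h 0| <= e (T + 1). That T is reached is shown with the supremum of
    the points up to which such a bound holds. *)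
Lemma abs_continuous_derive0 T h : 0 <= T -> abs_continuous 0 T h ->
  {ae mu, forall t : R, t \in `[0, T] -> is_derive t (1 : R) h 0} ->
  h T = h 0.
Proof.
move=> T0 ach [N [mN N0 dh]].
suff bnd (e : R) : 0 < e -> `|h T - h 0| <= e * (T + 1).
  apply/eqP; rewrite -subr_eq0 -normr_eq0; apply/eqP/le_anti.
  rewrite normr_ge0 andbT; apply/ler_addgt0Pr => e e0; rewrite add0r.
  have T1 : 0 < T + 1 by rewrite ltr_wpDl.
  by have := bnd (e / (T + 1)) (divr_gt0 e0 T1); rewrite divfK// gt_eqF.
move=> e0; have [d d0 dP] := ach _ e0.
have [U [oU NU Ud]] : exists U, [/\ open U, N `<=` U & (mu U < d%:E)%E].
  have Noo : (mu N < +oo)%E by rewrite N0.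
  have [U [oU NU Ud]] := lebesgue_regularity_outer mN Noo d0.
  exists U; split => //; apply: le_lt_trans Ud.
  have mU : measurable U by exact: open_measurable.
  rewrite -[X in (mu X <= _)%E](setDUK NU).
  apply: (@le_trans _ _ (mu N + mu (U `\` N))%E).
    by apply: measureU2 => //; exact: measurableD.
  by rewrite N0 add0e.
have mU : measurable U by exact: open_measurable.
pose P c := exists2 s, chain U c s &
  `|h c - h 0| <= e * c + \sum_(p <- s) `|h p.2 - h p.1|.
have step t : 0 <= t <= T -> exists2 r : R, 0 < r &
    forall c d, c <= t -> t <= d -> t - r < c -> d < t + r -> P c -> P d.
  move=> /andP[t0 tT]; have [Nt|Nt] := pselect (N t).
    have [r /= r0 rU] := (nbhs_ballP _ _).1 (open_nbhs_nbhs (conj oU (NU _ Nt))).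
    exists r => // a b a_t tb ra br [s sa sP].
    have ab : a <= b by exact: le_trans tb.
    exists ((a, b) :: s).
      split => //= x; rewrite /= in_itv/= => /andP[ax xb]; apply: rU.
      by rewrite ball_itv/= in_itv/= (lt_trans ra ax) (lt_trans xb br).
    rewrite big_cons/= addrCA; apply: le_trans (ler_distD (h a) _ _) _.
    rewrite lerD2l; apply: (le_trans sP); rewrite lerD2r.
    by rewrite ler_wpM2l// ltW.
  have dht : is_derive t (1 : R) h 0.
    apply: contrapT => ndh; apply: Nt; apply: dh => /= dht.
    by apply: ndh; apply: dht; rewrite in_itv/= t0.
  have [r r0 rP] := is_derive0_near dht e0.
  exists r => // a b a_t tb ra br [s sa sP].
  exists s; first by apply: chain_le sa; exact: le_trans tb.
  apply: le_trans (ler_distD (h t) _ _) _.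
  apply: le_trans (lerD (lexx _) (ler_distD (h a) _ _)) _.
  have htb : `|h b - h t| <= e * (b - t).
    by have := rP b; rewrite ger0_norm ?subr_ge0// ltrBlDl; exact.
  have hta : `|h t - h a| <= e * (t - a).
    rewrite distrC; have := rP a.
    by rewrite [`|a - t|]distrC ger0_norm ?subr_ge0// ltrBlDl -ltrBlDr; exact.
  apply: le_trans (lerD htb (lerD hta sP)) _.
  by rewrite le_eqVlt; apply/orP; left; apply/eqP; ring.
(* an interval around the supremum of the reachable points is reachable *)
pose S := [set c | 0 <= c <= T /\ P c].
have S0 : S 0.
  split; first by rewrite lexx.
  by exists [::] => //=; rewrite subrr normr0 big_nil addr0 mulr0.
have supS : has_sup S.
  by split; [exists 0|exists T => x [/andP[]]].
have t0 : 0 <= sup S by exact: ub_le_sup supS.2 _ S0.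
have tT : sup S <= T by apply: ge_sup => [|x [/andP[]]//]; exists 0.
have [|r r0 rP] := step (sup S); first by rewrite t0.
have [c Sc rc] := sup_adherent r0 supS.
have cS : c <= sup S by exact: ub_le_sup supS.2 _ Sc.
pose b := Num.min T (sup S + r / 2).
have Sb : sup S <= b by rewrite le_min tT lerDl divr_ge0// ltW.
have Pb : P b.
  apply: (rP c) => //; last by case: Sc.
  by rewrite /b gt_min ltrD2l ltr_pdivrMr// ltr_pMr// ltr1n orbT.
have : b <= sup S.
  apply: (ub_le_sup supS.2); split => //; rewrite (le_trans t0)//=.
  by rewrite ge_min lexx.
rewrite ge_min [_ + _ <= _]leNgt ltrDl divr_gt0// orbF => TS.
have bT : b = T by apply/le_anti; rewrite ge_min lexx/= (le_trans TS).
move: Pb; rewrite bT => -[s sT] /le_trans; apply.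
rewrite mulrDr mulr1 lerD2l; apply: ltW.
exact: (abs_continuous_chain dP mU Ud (lexx T) sT).
Qed.

End absolute_continuity.

(** * The fundamental theorem for absolutely continuous functions *)

Section ftc_absolute_continuity.
Context {R : realType}.
Local Notation mu := (@lebesgue_measure R).
Implicit Types (h w k l u v : R -> R) (T : R).

Lemma abs_continuousB (a b : R) h k : abs_continuous a b h ->
  abs_continuous a b k -> abs_continuous a b (h \- k).
Proof.
move=> ch ck e e0; have e20 : 0 < e / 2 by rewrite divr_gt0.
have [d1 d10 h1] := ch _ e20; have [d2 d20 h2] := ck _ e20.
exists (Num.min d1 d2) => [|n x y xy txy]; first by rewrite lt_min d10.
rewrite lt_min => /andP[s1 s2].
have := ltrD (h1 _ _ _ xy txy s1) (h2 _ _ _ xy txy s2).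
rewrite -splitr -big_split/=; apply: le_lt_trans.
apply: ler_sum => i _; rewrite -[X in _ <= _ + X]normrN.
by apply: le_trans (ler_normD _ _); rewrite le_eqVlt; apply/orP; left; apply/eqP;
  congr (`| _ |); ring.
Qed.

Lemma abs_continuous_sub (a b b' : R) h : b' <= b ->
  abs_continuous a b h -> abs_continuous a b' h.
Proof.
move=> b'b ch e e0; have [d d0 hd] := ch _ e0.
exists d => // n x y xy; apply: hd => i; have [ax xyi yb] := xy i.
by split => //; exact: le_trans b'b.
Qed.

(** The fundamental theorem of calculus: the difference of [h] and the
    primitive is absolutely continuous with zero derivative almost everywhere. *)
Lemma abs_continuous_primitiveE T h w : mu.-integrable setT (EFin \o w) ->
  abs_continuous 0 T h ->
  {ae mu, forall t : R, t \in `[0, T] -> is_derive t (1 : R) h (w t)} ->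
  forall t, 0 <= t <= T -> h t = h 0 + primitive w t.
Proof.
move=> iw ach dh t /andP[t0 tT].
have ach' := abs_continuous_sub tT ach.
have := @abs_continuous_derive0 _ _ _ t0
  (abs_continuousB ach' (@abs_continuous_primitive _ t _ iw)).
rewrite /= primitive0 subr0 => <-; first by rewrite subrK.
apply: (@filterS3 _ _ (ae_filter_ringOfSetsType mu) _ _ _ _ _ (ae_neq 0) dh
  (ae_is_derive_primitive iw)) => x x0 dhx dpx.
rewrite in_itv/= => /andP[x0' xt].
have hx : is_derive x (1 : R) h (w x) by apply: dhx; rewrite in_itv/= x0' (le_trans xt).
have px : is_derive x (1 : R) (primitive w) (w x).
  by apply: dpx; rewrite lt_neqAle eq_sym x0.
by apply: is_derive_eq; rewrite subrr.
Qed.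

End ftc_absolute_continuity.

(** * Convolution of integrable functions on a bounded interval *)

Section truncated_convolution.
Context {R : realType}.
Local Notation mu := (@lebesgue_measure R).
Implicit Types (h w k l u v : R -> R) (T : R).

Lemma causalL1_restrict (D : set R) u : measurable D -> D `<=` `[0, +oo[%classic ->
  mu.-integrable D (EFin \o u) -> causalL1 (u \_ D).
Proof.
move=> mD D0 iu; split.
  by rewrite -restrict_EFin; apply/(@integrable_mkcond _ _ _ mu D (EFin \o u) mD).
move=> t t0; rewrite patchE memNset// => /D0/=.
by rewrite in_itv/= andbT leNgt t0.
Qed.

Local Notation trunc T u := (u \_ `[0, T]%classic).

(** Restricted to [[0, T]], functions of [L1 T] enter the whole-line setting; at
    times up to T their convolutions do not see the restriction
    ([convT_truncE]). *)
Lemma causalL1_trunc T u : L1 T u -> causalL1 (trunc T u).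
Proof.
apply: causalL1_restrict => // x /=.
by rewrite !in_itv/= => /andP[->].
Qed.

Lemma truncE T u t : 0 <= t <= T -> (trunc T u) t = u t.
Proof. by move=> tT; rewrite patchE mem_set//= in_itv. Qed.

Lemma convT_truncE T k u t : t <= T ->
  convT (trunc T k) (trunc T u) t = conv k u t.
Proof.
move=> tT; have caus v : causal (trunc T v).
  by move=> x x0; rewrite patchE memNset//= in_itv/= leNgt x0.
rewrite convT_causalE//; apply: eq_conv => x /andP[x0 xt];
  by rewrite truncE// x0 (le_trans xt).
Qed.

Lemma L1_causalL1 T u : causalL1 u -> L1 T u.
Proof. by move=> [iu _]; apply: integrableS iu. Qed.

Lemma eq_L1 T u v : (forall t, 0 <= t <= T -> u t = v t) -> L1 T u -> L1 T v.
Proof.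
move=> uv; apply: eq_integrable => // t /set_mem/=.
by rewrite in_itv/= => /uv ->.
Qed.

Lemma L1_conv T k u : L1 T k -> L1 T u -> L1 T (conv k u).
Proof.
move=> hk hu.
apply: (@eq_L1 _ (convT (trunc T k) (trunc T u))) => [t /andP[_ tT]|].
  exact: convT_truncE.
by apply: L1_causalL1; apply: causalL1_convT; exact: causalL1_trunc.
Qed.

(** Tails of the difference integrate to 0 by [laplace_nat0_tail], hence so
    does its primitive, and [primitive_ae0] applies. *)
Lemma laplace_nat_inj_ae T u v : causalL1 u -> causalL1 v ->
  (forall n, laplace_nat u n = laplace_nat v n) ->
  {ae mu, forall t : R, t \in `[0, T] -> u t = v t}.
Proof.
move=> hu hv uv; have huv := causalL1B hu hv.
have l0 n : laplace_nat (u \- v) n = 0 by rewrite laplace_natB// uv subrr.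
suff : {ae mu, forall t : R, t \in `[0, T] -> (u \- v) t = 0}.
  apply: (@filterS _ _ (ae_filter_ringOfSetsType mu)) => t /[apply] /eqP.
  by rewrite subr_eq0 => /eqP.
have [iuv _] := huv.
apply: primitive_ae0 => //; apply: aeW => t; rewrite in_itv/= => /andP[t0 _].
have tail a := laplace_nat0_tail a huv l0.
have := @Rintegral_itvB _ (u \- v) (BRight (-1)) +oo%O t.
rewrite !tail sub0r => /(_ _ _ _)/eqP; rewrite oppr_eq0 => /(_ _ _ _)/eqP <-//.
- rewrite /primitive [LHS]Rintegral_mkcond [RHS]Rintegral_mkcond.
  apply: eq_Rintegral => x _; rewrite !patchE.
  have [x0|x0] := ltP x 0; first by have [_ ->//] := huv; rewrite !if_same.
  by rewrite !mem_setE !in_itv/= x0 (lt_le_trans _ x0)// ltrN10.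
- exact: integrableS iuv.
- by rewrite bnd_simp (le_trans _ t0)// lerN10.
Qed.

(** Both sides have the same transform, a product of three factors. *)
Lemma conv_assoc_ae T k l u : L1 T k -> L1 T l -> L1 T u ->
  {ae mu, forall t : R, t \in `[0, T] -> conv k (conv l u) t = conv (conv k l) u t}.
Proof.
move=> /causalL1_trunc hk /causalL1_trunc hl /causalL1_trunc hu.
have hlu := causalL1_convT hl hu; have hkl := causalL1_convT hk hl.
have := laplace_nat_inj_ae T (causalL1_convT hk hlu) (causalL1_convT hkl hu).
move=> H; have {H} /H : forall n,
    laplace_nat (convT (trunc T k) (convT (trunc T l) (trunc T u))) n =
    laplace_nat (convT (convT (trunc T k) (trunc T l)) (trunc T u)) n.
  by move=> n; rewrite !laplace_nat_convT// mulrA.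
apply: (@filterS _ _ (ae_filter_ringOfSetsType mu)) => t /[swap] tT /(_ tT).
move: tT; rewrite in_itv/= => /andP[t0 tT].
have le_T x : 0 <= x <= t -> 0 <= x <= T.
  by move=> /andP[-> xt]; exact: le_trans tT.
rewrite (convT_causalE (proj2 hk) (proj2 hlu)).
rewrite (convT_causalE (proj2 hkl) (proj2 hu)).
rewrite (eq_conv (a' := k) (b' := conv l u)); first last.
- by move=> x /le_T/andP[_ xT]; rewrite convT_truncE.
- by move=> x /le_T xT; rewrite truncE.
move=> ->; apply: eq_conv => x /le_T xT; last by rewrite truncE.
by case/andP: xT => _ xT; rewrite convT_truncE.
Qed.

Lemma convC_ae T k u : L1 T k -> L1 T u ->
  {ae mu, forall t : R, t \in `[0, T] -> conv k u t = conv u k t}.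
Proof.
move=> /causalL1_trunc hk /causalL1_trunc hu.
have := laplace_nat_inj_ae T (causalL1_convT hk hu) (causalL1_convT hu hk).
move=> H; have {H} /H : forall n, laplace_nat (convT (trunc T k) (trunc T u)) n =
    laplace_nat (convT (trunc T u) (trunc T k)) n.
  by move=> n; rewrite !laplace_nat_convT// mulrC.
apply: (@filterS _ _ (ae_filter_ringOfSetsType mu)) => t /[swap] tT /(_ tT).
by move: tT; rewrite in_itv/= => /andP[t0 tT]; rewrite !convT_truncE.
Qed.

Lemma ae_eq_conv T k u v : L1 T k -> L1 T u -> L1 T v ->
  {ae mu, forall t : R, t \in `[0, T] -> u t = v t} ->
  forall t, 0 <= t <= T -> conv k u t = conv k v t.
Proof.
move=> hk hu hv uv t /andP[t0 tT].
rewrite -!(@convT_truncE T)//.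
have /measurable_causalL1 mk := causalL1_trunc hk.
have mkt : measurable_fun [set: R] (fun x => (trunc T k) (t - x)).
  by apply: (measurableT_comp mk); exact: measurable_funB.
congr fine; apply: ae_eq_integral => //.
- apply/measurable_EFinP/measurable_funM => //.
  exact: measurable_causalL1 (causalL1_trunc hu).
- apply/measurable_EFinP/measurable_funM => //.
  exact: measurable_causalL1 (causalL1_trunc hv).
apply: (@filterS _ _ (ae_filter_ringOfSetsType mu)) uv => x uvx _ /=.
suff -> : (trunc T u) x = (trunc T v) x by [].
by rewrite !patchE; case: ifPn => // xT; apply: uvx; exact: (set_mem xT).
Qed.

Lemma convDr_ae T k u v : L1 T k -> L1 T u -> L1 T v ->
  {ae mu, forall t : R, t \in `[0, T] ->
    conv k (u \+ v) t = conv k u t + conv k v t}.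
Proof.
move=> /causalL1_trunc[hk _] /causalL1_trunc[hu _] /causalL1_trunc[hv _].
apply: (@filterS2 _ _ (ae_filter_ringOfSetsType mu) _ _ _ _
  (convT_ae_integrable hk hu) (convT_ae_integrable hk hv)) => t iu iv.
rewrite in_itv/= => /andP[t0 tT].
rewrite -!(@convT_truncE T)// /convT -RintegralD//.
apply: eq_Rintegral => x _; rewrite -mulrDr; congr (_ * _).
by rewrite !patchE; case: ifP => // _; rewrite addr0.
Qed.

Lemma convZr T k u (c : R) : L1 T k -> L1 T u ->
  forall t, 0 <= t <= T -> conv k (fun x => c * u x) t = c * conv k u t.
Proof.
move=> hk hu t /andP[t0 tT].
have [->|c0] := eqVneq c 0.
  rewrite mul0r /conv; under eq_Rintegral do rewrite mul0r mulr0.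
  by rewrite Rintegral_cst// mul0r.
have /measurable_causalL1 mk := causalL1_trunc hk.
have /measurable_causalL1 mu_ := causalL1_trunc hu.
rewrite -!(@convT_truncE T)// /convT -RintegralZl_measurable//; last first.
  apply: measurable_funM => //.
  by apply: (measurableT_comp mk); exact: measurable_funB.
apply: eq_Rintegral => x _; rewrite mulrCA; congr (_ * _).
by rewrite !patchE; case: ifP => // _; rewrite mulr0.
Qed.

End truncated_convolution.

(** * The Laplace transform at real points and the two kernels *)

Section complex_laplace.
Context {R : realType}.
Local Notation mu := (@lebesgue_measure R).
Local Open Scope complex_scope.
Implicit Types (g : R -> R) (r : R) (z : R[i]).

Lemma cexpD (z w : R[i]) : cexp (z + w) = cexp z * cexp w.
Proof.
case: z w => [a b] [c d]; rewrite /cexp/= expRD cosD sinD.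
by apply/eqP; rewrite eq_complex/=; apply/andP; split; apply/eqP; ring.
Qed.

Lemma cexp_real r : cexp r%:C = (expR r)%:C.
Proof. by rewrite /cexp/= cos0 sin0 mulr1 mulr0. Qed.

Lemma cln_real r : 0 < r -> cln r%:C = (ln r)%:C.
Proof.
move=> r0; have nr : Normc.normc (r%:C) = r.
  by rewrite /= expr0n/= addr0 sqrtr_sqr gtr0_norm.
by rewrite /cln /carg nr/= lexx divff ?gt_eqF// acos1.
Qed.

(** At a real point s > 0 this is s^(z - 1) s^(- z) = s^(-1), with ln s real; it
    makes the product of the transforms of the two kernels equal to s^(-1). *)
Lemma cpow_subr1_oppr r z : 0 < r ->
  cpow r%:C (z - 1) * cpow r%:C (- z) = (r^-1)%:C.
Proof.
move=> r0; rewrite /cpow -cexpD -mulrDl.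
rewrite (_ : z - 1 + - z = -1); last by ring.
by rewrite mulN1r cln_real// -rmorphN cexp_real expRN lnK.
Qed.

Lemma laplace_integrand_real g r t :
  laplace_integrand g r%:C t = (damp r g t)%:C.
Proof.
by rewrite /laplace_integrand -rmorphM -rmorphN cexp_real -rmorphM.
Qed.

Lemma laplace_real g r :
  laplace g r%:C = (\int[mu]_(t in `[0, +oo[) damp r g t)%:C.
Proof.
rewrite /laplace /cintegral; congr (_ +i* _).
  by apply: eq_Rintegral => t _; rewrite laplace_integrand_real.
under eq_Rintegral do rewrite laplace_integrand_real/=.
by rewrite Rintegral_cst// mul0r.
Qed.

Lemma cintegrable_real g r :
  cintegrable `[0, +oo[ (laplace_integrand g r%:C) ->
  mu.-integrable `[0, +oo[ (EFin \o damp r g).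
Proof.
move=> [+ _]; apply: eq_integrable => // t _.
by rewrite /comp laplace_integrand_real.
Qed.

Definition causal_part g := g \_ `[0, +oo[%classic.

Lemma laplace_nat_damp g r n :
  laplace_nat (damp r (causal_part g)) n = \int[mu]_(t in `[0, +oo[) damp (r + n%:R) g t.
Proof.
rewrite /laplace_nat [RHS]Rintegral_mkcond; apply: eq_Rintegral => t _.
rewrite /causal_part /damp !patchE; case: ifP => _; last by rewrite !mulr0.
by rewrite mulrA -expRD; congr (expR _ * _); ring.
Qed.

Lemma causalL1_damp_causal_part g r :
  mu.-integrable `[0, +oo[ (EFin \o damp r g) -> causalL1 (damp r (causal_part g)).
Proof.
move=> ig; have -> : damp r (causal_part g) = damp r g \_ `[0, +oo[%classic.
  apply/funext => t; rewrite /damp /causal_part !patchE.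
  by case: ifP => // _; rewrite mulr0.
exact: causalL1_restrict.
Qed.

Lemma measurable_causal_part g r :
  mu.-integrable `[0, +oo[ (EFin \o damp r g) -> measurable_fun [set: R] (causal_part g).
Proof.
move=> ig; apply/(measurable_restrictT _ _).1 => //.
have /measurable_EFinP := measurable_int _ ig => /(measurable_damp (- r)).
apply: eq_measurable_fun => t _; rewrite /damp mulrA -expRD.
by rewrite (_ : _ + _ = 0) ?expR0 ?mul1r//; ring.
Qed.

(** The transform of the constant 1 is s^(-1), since the exponential law has
    total mass 1. *)
Lemma integral_damp1 r : 0 < r ->
  mu.-integrable `[0, +oo[ (EFin \o damp r (cst 1)) /\
  \int[mu]_(t in `[0, +oo[) damp r (cst 1) t = r^-1.
Proof.
move=> r0; have ip := integrable_exponential_pdf r0.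
have E t : exponential_pdf r t * r^-1 = damp r (causal_part (cst 1)) t.
  rewrite /exponential_pdf /damp /causal_part !patchE.
  case: ifP => _; last by rewrite mul0r mulr0.
  by rewrite mulr1 mulrC mulKf ?gt_eqF// mulNr.
split.
  apply/(@integrable_mkcond _ _ _ mu _ (EFin \o damp r (cst 1)) (measurable_itv _)).
  rewrite restrict_EFin.
  have := @integrableZr _ _ _ mu setT measurableT r^-1 _ ip.
  apply: eq_integrable => // t _; rewrite /= -EFinM E /damp /causal_part !patchE.
  by case: ifP => // _; rewrite mulr0.
have := @laplace_nat_damp (cst 1) r 0; rewrite addr0 => <-.
rewrite /laplace_nat; under eq_Rintegral do rewrite /damp mul0r oppr0 expR0 mul1r.
under eq_Rintegral do rewrite -/(damp _ _ _) -E.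
rewrite RintegralZr//= /Rintegral integral_exponential_pdf//=.
by rewrite mul1r.
Qed.

(** Both sides, weighted by e^(-r t) with r in the common half-plane of
    convergence, are integrable and have transform (r + n)^(-1) at n. *)
Lemma conv_phi_psi T alpha phi psi :
  inverse_laplace (scarpi_Phi alpha) phi ->
  inverse_laplace (scarpi_Psi alpha) psi ->
  {ae mu, forall t : R, t \in `[0, T] -> conv phi psi t = 1}.
Proof.
move=> [s1 s10 hphi] [s2 s20 hpsi].
pose r := Num.max s1 s2 + 1.
have r1 : s1 < r by rewrite /r ltr_pwDr// le_max lexx.
have r2 : s2 < r by rewrite /r ltr_pwDr// le_max lexx orbT.
have r0 : 0 < r by exact: le_lt_trans r1.
have ia : causalL1 (damp r (causal_part phi)).
  by apply: causalL1_damp_causal_part; apply: cintegrable_real; have [] := hphi r%:C r1.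
have ib : causalL1 (damp r (causal_part psi)).
  by apply: causalL1_damp_causal_part; apply: cintegrable_real; have [] := hpsi r%:C r2.
have i1 : causalL1 (damp r (causal_part (cst 1))).
  by apply: causalL1_damp_causal_part; have [] := integral_damp1 r0.
have := laplace_nat_inj_ae T (causalL1_convT ia ib) i1.
move=> H; have {H} /H : forall n,
    laplace_nat (convT (damp r (causal_part phi)) (damp r (causal_part psi))) n =
    laplace_nat (damp r (causal_part (cst 1))) n.
  move=> n; rewrite laplace_nat_convT// !laplace_nat_damp.
  have rn : r <= r + n%:R by rewrite lerDl.
  have [_ ->] := integral_damp1 (lt_le_trans r0 rn).
  have [_] := hphi (r + n%:R)%:C (lt_le_trans r1 rn).
  have [_] := hpsi (r + n%:R)%:C (lt_le_trans r2 rn).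
  rewrite !laplace_real => hb ha.
  have := cpow_subr1_oppr ((r + n%:R)%:C * laplace alpha (r + n%:R)%:C) (lt_le_trans r0 rn).
  by rewrite -[cpow _ (_ - 1)]ha -[cpow _ (- _)]hb -rmorphM/= => -[].
apply: (@filterS _ _ (ae_filter_ringOfSetsType mu)) => t /[swap] tT /(_ tT).
move: tT; rewrite in_itv/= => /andP[t0 tT].
rewrite damp_convT; last 2 first.
- by apply: (@measurable_causal_part _ r); apply: cintegrable_real; have [] := hphi r%:C r1.
- by apply: (@measurable_causal_part _ r); apply: cintegrable_real; have [] := hpsi r%:C r2.
move=> /(mulfI (lt0r_neq0 (expR_gt0 _))).
have half0 u : causal (causal_part u).
  by move=> x x0; rewrite /causal_part patchE memNset//= in_itv/= andbT leNgt x0.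
have halfE u x : 0 <= x -> causal_part u x = u x.
  by move=> x0; rewrite /causal_part patchE mem_set//= in_itv/= x0.
rewrite convT_causalE// halfE// => H; rewrite -[RHS]H.
by apply: eq_conv => x /andP[x0 _]; rewrite halfE.
Qed.

End complex_laplace.

(** * Inversion *)

Section scarpi_inversion.
Context {R : realType}.
Local Notation mu := (@lebesgue_measure R).
Implicit Types (f g phi psi : R -> R) (T : R).

(** On a bounded interval the weight e^(-r t) is bounded away from 0. *)
Lemma inverse_laplace_L1 T (G : R[i] -> R[i]) g : inverse_laplace G g -> L1 T g.
Proof.
move=> [s s0 hg]; pose r := s + 1.
have sr : s < complex.Re (r%:C)%C by rewrite /= ltrDl.
have [/cintegrable_real ig _] := hg _ sr.
have /measurable_causal_part mg := ig.
have [T0|T0] := leP 0 T; last first.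
  by rewrite /L1 set_itv_ge ?bnd_simp -?ltNge//; exact: integrable_set0.
have iT : mu.-integrable `[0, T] (EFin \o damp r g).
  apply: (integrableS _ _ _ ig) => // x /=.
  by rewrite !in_itv/= => /andP[->].
have ib : mu.-integrable `[0, T] (EFin \o (fun t => expR (r * T) * damp r g t)).
  exact: (@integrableZl _ _ _ mu _ (measurable_itv _) (expR (r * T)) _ iT).
apply: le_integrable ib => //.
  apply/measurable_EFinP.
  have : measurable_fun `[0, T] (causal_part g) by exact: measurable_funS mg.
  apply: eq_measurable_fun => t /set_mem/=; rewrite in_itv/= => /andP[t0 _].
  by rewrite /causal_part patchE mem_set//= in_itv/= t0.
move=> t; rewrite /= in_itv/= => /andP[t0 tT]; rewrite lee_fin /damp mulrA -expRD.
rewrite normrM ler_peMl// ger0_norm ?expR_ge0// -expR0 ler_expR.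
by rewrite subr_ge0 ler_wpM2l// addr_ge0.
Qed.

Lemma conv1l f t : conv (cst 1) f t = primitive f t.
Proof. by apply: eq_Rintegral => x _; rewrite mul1r. Qed.

Lemma conv0E k f : conv k f 0 = 0.
Proof. by rewrite /conv set_itv1 Rintegral_set1. Qed.

Lemma L1_cst T c : L1 T (cst c).
Proof.
apply/integrableP; split; first exact/measurable_EFinP/measurable_cst.
rewrite (eq_integral (cst `|c%:E|%E))// integral_cst//=.
rewrite lebesgue_measure_itv/=; case: ifP => // _; last by rewrite mule0 ltry.
by rewrite -EFinB -EFinM ltry.
Qed.

Lemma L1D T u v : L1 T u -> L1 T v -> L1 T (u \+ v).
Proof. exact: (@integrableD _ _ _ mu _ (measurable_itv _)). Qed.

Lemma L1Z T (c : R) u : L1 T u -> L1 T (fun x => c * u x).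
Proof. exact: (@integrableZl _ _ _ mu _ (measurable_itv _)). Qed.

Lemma primitive_trunc T v t : 0 <= t <= T ->
  primitive (v \_ `[0, T]%classic) t = conv (cst 1) v t.
Proof.
move=> /andP[t0 tT]; rewrite conv1l.
apply: eq_Rintegral => x /set_mem/=; rewrite in_itv/= => /andP[x0 xt].
by rewrite truncE// x0 (le_trans xt).
Qed.

(** Obtained by commuting and associating, each valid almost everywhere; the
    inner commutation holds under the outer integral ([ae_eq_conv]). *)
Lemma conv_left_comm_ae T k l u : L1 T k -> L1 T l -> L1 T u ->
  {ae mu, forall t : R, t \in `[0, T] -> conv k (conv l u) t = conv l (conv k u) t}.
Proof.
move=> hk hl hu; have hlu := L1_conv hl hu; have hul := L1_conv hu hl.
have := convC_ae (L1_conv hk hu) hl; have := conv_assoc_ae hk hu hl.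
apply: (@filterS2 _ _ (ae_filter_ringOfSetsType mu)) => t c1 c2 tT.
have tT' : 0 <= t <= T by move: tT; rewrite in_itv.
rewrite (ae_eq_conv hk hlu hul (convC_ae hl hu) tT').
by rewrite (c1 tT) (c2 tT).
Qed.

Lemma conv_inverse_ae T k l u : L1 T k -> L1 T l -> L1 T u ->
  {ae mu, forall t : R, t \in `[0, T] -> conv k l t = 1} ->
  {ae mu, forall t : R, t \in `[0, T] -> conv k (conv l u) t = conv (cst 1) u t}.
Proof.
move=> hk hl hu kl1; have hkl := L1_conv hk hl; have h1 := L1_cst T (1 : R).
have := conv_assoc_ae hk hl hu; have := convC_ae hkl hu; have := convC_ae hu h1.
apply: (@filterS3 _ _ (ae_filter_ringOfSetsType mu)) => t c1 c2 c3 tT.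
by rewrite c3// c2// (ae_eq_conv hu hkl h1 kl1) ?c1.
Qed.


(** The absolutely continuous representative of phi * (psi * f) = 1 * f is the
    primitive of [f]; the correction term vanishes since (psi * f)(0) = 0. *)
Lemma scarpi_derivative_integral T phi psi f : 
  L1 T phi -> L1 T psi -> L1 T f ->
  {ae mu, forall t : R, t \in `[0, T] -> conv phi psi t = 1} ->
  scarpi_derivative T phi (conv psi f) f.
Proof.
move=> hphi hpsi hf pp1.
have [iF _] := causalL1_trunc hf.
split => //; first exact: L1_conv.
exists f; last first.
  by apply: aeW => t _; rewrite conv0E mulr0 subr0.
exists (primitive (f \_ `[0, T]%classic)); split.
- exact: abs_continuous_primitive.
- by rewrite primitive0 conv0E.
- have := conv_inverse_ae hphi hpsi hf pp1.
  apply: (@filterS _ _ (ae_filter_ringOfSetsType mu)) => t + tT => ->//.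
  by rewrite primitive_trunc.
- have := ae_is_derive_primitive iF.
  apply: (@filterS2 _ _ (ae_filter_ringOfSetsType mu) _ _ _ _ (ae_neq 0)) => t tn0 + tT.
  rewrite truncE//; apply; move: tT; rewrite in_itv/= => /andP[t0 _].
  by rewrite lt_neqAle eq_sym tn0.
Qed.

(** The representative [h] of phi * f is the primitive of v = g + f(0) phi.
    Convolving phi * f = 1 * v with psi gives 1 * f = 1 * (psi * v) with
    psi * v = psi * g + f(0), and the primitive determines its integrand. *)
Lemma scarpi_integral_derivative T phi psi f g : 
  L1 T phi -> L1 T psi -> 
  {ae mu, forall t : R, t \in `[0, T] -> conv phi psi t = 1} ->
  scarpi_derivative T phi f g ->
  {ae mu, forall t : R, t \in `[0, T] -> conv psi g t = f t - f 0}.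
Proof.
move=> hphi hpsi pp1 [hf hg [w [h [ach h0 fh dh]] gw]].
pose fphi x := f 0 * phi x; pose v := g \+ fphi.
have hfphi : L1 T fphi by exact: L1Z.
have hv : L1 T v by exact: L1D.
have [iV _] := causalL1_trunc hv.
have h1 := L1_cst T (1 : R).
have hE : forall t, 0 <= t <= T -> h t = conv (cst 1) v t.
  move=> t tT; rewrite -(primitive_trunc v tT).
  rewrite (abs_continuous_primitiveE iV ach _ tT) ?h0 ?conv0E ?add0r//.
  apply: (@filterS2 _ _ (ae_filter_ringOfSetsType mu) _ _ _ _ gw dh) => x gwx dhx xT.
  by rewrite truncE// /v/= /fphi gwx// mulrC subrK; exact: dhx.
have phif : {ae mu, forall t : R, t \in `[0, T] -> conv phi f t = conv (cst 1) v t}.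
  apply: (@filterS _ _ (ae_filter_ringOfSetsType mu) _ _ _ fh) => t fht tT.
  by rewrite fht// hE.
have psiphi1 : {ae mu, forall t : R, t \in `[0, T] -> conv psi phi t = 1}.
  apply: (@filterS2 _ _ (ae_filter_ringOfSetsType mu) _ _ _ _ pp1 (convC_ae hpsi hphi)).
  by move=> t p1 c tT; rewrite c// p1.
pose q := conv psi g \+ cst (f 0).
have hq : L1 T q by apply: L1D; [exact: L1_conv|exact: L1_cst].
have psiv : {ae mu, forall t : R, t \in `[0, T] -> conv psi v t = q t}.
  apply: (@filterS2 _ _ (ae_filter_ringOfSetsType mu) _ _ _ _
    (convDr_ae hpsi hg hfphi) psiphi1) => t cD p1 tT.
  by rewrite cD// (convZr _ hpsi hphi)// p1// mulr1.
have hfq : L1 T (f \- q) by have := @integrableB _ _ _ mu _ (measurable_itv _) _ _ hf hq.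
have [iFq _] := causalL1_trunc hfq.
suff : {ae mu, forall t : R, t \in `[0, T] -> ((f \- q) \_ `[0, T]%classic) t = 0}.
  apply: (@filterS _ _ (ae_filter_ringOfSetsType mu)) => t fq tT; move: (fq tT).
  by rewrite truncE// /q/= => /eqP; rewrite subr_eq0 => /eqP ->; rewrite addrK.
apply: primitive_ae0 => //.
apply: (@filterS2 _ _ (ae_filter_ringOfSetsType mu) _ _ _ _
  (conv_inverse_ae hpsi hphi hf psiphi1) (conv_left_comm_ae hpsi h1 hv)) => t ci cl tT.
have tT' : 0 <= t <= T by move: tT; rewrite in_itv.
have iS u : L1 T u -> mu.-integrable `[0, t] (EFin \o u).
  apply: integrableS => //; apply: subset_itvl; rewrite bnd_simp.
  by case/andP: tT'.
rewrite (primitive_trunc _ tT') conv1l /primitive.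
rewrite RintegralB; [|exact: measurable_itv|exact: (iS f)|exact: (iS q)].
apply/eqP; rewrite subr_eq0; apply/eqP.
rewrite -/(primitive f t) -/(primitive q t) -!conv1l.
rewrite -(ci tT) (ae_eq_conv hpsi (L1_conv hphi hf) (L1_conv h1 hv) phif tT').
by rewrite (cl tT) (ae_eq_conv h1 (L1_conv hpsi hv) hq psiv tT').
Qed.

End scarpi_inversion.

Unset Implicit Arguments.

Theorem proposition2p2 (R : realType) (T : R) (alpha phi psi f : R -> R)
    (T_gt0 : 0 < T)
    (alpha_loc : locally_integrable_0y alpha)
    (alpha01 : forall t : R, 0 <= t -> 0 < alpha t < 1)
    (phiP : inverse_laplace (scarpi_Phi alpha) phi)
    (psiP : inverse_laplace (scarpi_Psi alpha) psi)
    (fL1 : L1 T f) :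
  scarpi_derivative T phi (scarpi_integral psi f) f /\
  (forall g : R -> R, scarpi_derivative T phi f g ->
    {ae @lebesgue_measure R, forall t : R, t \in `[0, T] ->
       scarpi_integral psi g t = f t - f 0}).
Proof.
have hphi := inverse_laplace_L1 T phiP; have hpsi := inverse_laplace_L1 T psiP.
have pp1 := conv_phi_psi T phiP psiP.
split; first exact: scarpi_derivative_integral.
by move=> g; exact: scarpi_integral_derivative.
Qed.
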